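(* Let $\lambda>-1$ and $t\in\mathbb{R}$, and consider the generalised sextic Freud weight $\omega(x;t,\lambda)=|x|^{2\lambda+1}\exp(-x^6+tx^2)$, $x\in\mathbb{R}$. Then its first moment $\mu_0(t;\lambda)$ is given by \begin{align*} \mu_0(t;\lambda)&=\int_{-\infty}^{\infty}|x|^{2\lambda+1}\exp(-x^6+tx^2)\,dx=\int_0^\infty s^{\lambda}\exp(ts-s^3)\,ds\\ &=\tfrac13\Gamma(\tfrac13\lambda+\tfrac13)\;{}_1F_2\left(\tfrac13\lambda+\tfrac13;\tfrac13,\tfrac23;(\tfrac13t)^3\right)+\tfrac13\,t\,\Gamma(\tfrac13\lambda+\tfrac23)\;{}_1F_2\left(\tfrac13\lambda+\tfrac23;\tfrac23,\tfrac43;(\tfrac13t)^3\right)\\ &\qquad+\tfrac16\,t^2\,\Gamma(\tfrac13\lambda+1)\;{}_1F_2\left(\tfrac13\lambda+1;\tfrac43,\tfrac53;(\tfrac13t)^3\right). \end{align*}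
   Context: ${}_1F_2(a_1;b_1,b_2;z)=\sum_{k=0}^\infty\frac{(a_1)_k}{(b_1)_k(b_2)_k}\frac{z^k}{k!}$ is the generalised hypergeometric function, where $(a)_k=a(a+1)\cdots(a+k-1)$, $(a)_0=1$. The ''first moment'' means $\mu_0$, the integral of the weight over $\mathbb{R}$. *)

(* Defs.v *)
From mathcomp Require Import all_boot all_order all_algebra.
From mathcomp Require Import all_classical all_reals all_analysis.
Import Order.TTheory GRing.Theory Num.Theory.
Import numFieldNormedType.Exports.

Set Implicit Arguments.
Unset Strict Implicit.
Unset Printing Implicit Defensive.

Local Open Scope classical_set_scope.
Local Open Scope ring_scope.

(* Euler's integral: this is the Gamma function only for [0 < x]. *)
Definition Gamma (R : realType) (x : R) : R :=
  (\int[lebesgue_measure]_(u in `]0, +oo[) (u `^ (x - 1) * expR (- u)))%R.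

Definition pochhammer (R : realType) (a : R) (k : nat) : R :=
  \prod_(i < k) (a + i%:R).

Definition hypergeometric1F2 (R : realType) (a1 b1 b2 z : R) : R :=
  limn [series pochhammer a1 k / (pochhammer b1 k * pochhammer b2 k)
               * (z ^+ k / k`!%:R)]_k.

Definition sextic_freud_weight (R : realType) (t lambda x : R) : R :=
  `|x| `^ (2 * lambda + 1) * expR (- x ^+ 6 + t * x ^+ 2).

(* The weight is nonnegative, so its integral always exists in [\bar R]. *)
Definition sextic_freud_mu0 (R : realType) (t lambda : R) : \bar R :=
  (\int[lebesgue_measure]_x (sextic_freud_weight t lambda x)%:E)%E.

(* Main.v *)
Require Import Defs.
From mathcomp Require Import all_boot all_order all_algebra.
From mathcomp Require Import all_classical all_reals all_analysis.
From mathcomp Require Import measurable_realfun ring lra.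
Import Order.TTheory GRing.Theory Num.Theory.
Import numFieldNormedType.Exports.

(* The weight is even, so the substitution [s = x ^ 2] turns its integral into
   [\int_0^oo s^lambda exp(t s - s^3) ds].  Expand [exp(t s)] and integrate
   termwise: [s = u^(1/3)] gives
   [\int_0^oo s^(lambda + m) exp(- s^3) ds = Gamma((lambda + m + 1) / 3) / 3],
   and splitting the series according to [m mod 3] yields the three [1F2],
   because [Gamma(a + k) = (a)_k Gamma(a)] and
   [(3k + j)! = j! 27^k ((j+1)/3)_k ((j+2)/3)_k ((j+3)/3)_k],
   where one of the three Pochhammer symbols is [(1)_k = k!].  Termwise
   integration is dominated convergence for each residue class, the partial
   sums being bounded by [exp(|t| s)]. *)

Set Implicit Arguments.
Unset Strict Implicit.
Unset Printing Implicit Defensive.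

Local Open Scope classical_set_scope.
Local Open Scope ring_scope.

Local Notation mu := lebesgue_measure (only parsing).

(** * Exhaustion of the open half-line by compact intervals *)

Lemma powR_exhaust {R : realType} (p x : R) : 0 < p -> 0 < x ->
  exists n : nat, n.+1%:R `^ (- p) <= x <= n.+1%:R `^ p.
Proof.
move=> p0 x0.
(* [M] dominates the [p]-th roots of both [x] and [x^-1], so a single integer above [M] gives the
   upper bound directly and the lower bound by inversion. *)
pose M := x `^ p^-1 + x^-1 `^ p^-1.
have M0 : 0 <= M by rewrite addr_ge0// powR_ge0.
exists (Num.truncn M).
have Mn : M <= (Num.truncn M).+1%:R by exact/ltW/truncnS_gt.
have pK y : 0 < y -> y = (y `^ p^-1) `^ p.
  by move=> y0; rewrite -powRrM mulVf ?gt_eqF// powRr1// ltW.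
have le_n y : 0 < y -> y `^ p^-1 <= M -> y <= (Num.truncn M).+1%:R `^ p.
  move=> y0 yM; rewrite {1}(pK _ y0); apply: ge0_ler_powR.
  - exact: ltW.
  - by rewrite nnegrE powR_ge0.
  - by rewrite nnegrE.
  - exact: le_trans Mn.
apply/andP; split.
  rewrite powRN -[leRHS]invrK lef_pV2 ?posrE ?invr_gt0 ?powR_gt0//.
  by apply: le_n; rewrite ?invr_gt0// lerDr powR_ge0.
by apply: le_n => //; rewrite lerDl powR_ge0.
Qed.

(* The exponent [p] is there so that [x |-> x `^ p] maps [expanding_itv 1 n]
   onto [expanding_itv p n]. *)
Definition expanding_itv {R : realType} (p : R) (n : nat) : set R :=
  `[n.+1%:R `^ (- p), n.+1%:R `^ p]%classic.

Lemma bigcup_expanding_itv {R : realType} (p : R) : 0 < p ->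
  \bigcup_n expanding_itv p n = `]0, +oo[%classic.
Proof.
move=> p0; apply/seteqP; split => [x [n _]|x];
  rewrite /expanding_itv/= !in_itv/= ?andbT.
  by move=> /andP[+ _]; apply: lt_le_trans; exact: powR_gt0.
by move=> /(powR_exhaust p0)[n ?]; exists n => //=; rewrite in_itv.
Qed.

Lemma nondecreasing_expanding_itv {R : realType} (p : R) : 0 < p ->
  nondecreasing_seq (expanding_itv p).
Proof.
move=> p0; apply/nondecreasing_seqP => n; rewrite subsetEset => x.
rewrite /expanding_itv/=.
have H : n.+1%:R `^ p <= n.+2%:R `^ p :> R.
  by apply: ge0_ler_powR; rewrite ?nnegrE ?ler_nat// ltW.
rewrite !in_itv/= => /andP[nx xn]; rewrite (le_trans xn H) andbT.
by apply: le_trans nx; rewrite !powRN lef_pV2// posrE powR_gt0.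
Qed.

(** Monotone convergence. It carries identities known on segments (substitution, reflection,
    integration by parts) over to the half-line, without any prior integrability. *)
Lemma ge0_integral_expanding_itv_cvg {R : realType} (p : R) (f : R -> R) : 0 < p ->
  measurable_fun (`]0, +oo[%classic : set R) f -> (forall x, 0 < x -> 0 <= f x) ->
  (\int[mu]_(x in expanding_itv p n) (f x)%:E
    @[n --> \oo] --> \int[mu]_(x in `]0%R, +oo[) (f x)%:E)%E.
Proof.
move=> p0 mf f0; rewrite -(bigcup_expanding_itv p0).
apply: ge0_nondecreasing_set_cvg_integral.
- exact: nondecreasing_expanding_itv.
- by move=> i; exact: measurable_itv.
- move=> i; apply/measurable_EFinP; apply: measurable_funS mf => //.
  by rewrite -(bigcup_expanding_itv p0); exact: bigcup_sup.
- move=> i x; rewrite /expanding_itv/= in_itv/= => /andP[+ _] => h.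
  rewrite lee_fin f0//.
  exact: lt_le_trans h.
Qed.

Lemma continuous_oy_measurable {R : realType} (f : R -> R) :
  {in `]0, +oo[, continuous f} -> measurable_fun (`]0, +oo[%classic : set R) f.
Proof.
move=> cf; apply: open_continuous_measurable_fun => //.
by move=> x; rewrite inE => /cf.
Qed.

Lemma continuous_powR {R : realType} (p : R) :
  {in `]0, +oo[, continuous (@powR R ^~ p)}.
Proof.
move=> x x0; apply: differentiable_continuous; apply/derivable1_diffP.
exact: derivable_powR.
Qed.

Lemma within_continuous_oy {R : realType} (f : R -> R) a b : 0 < a ->
  {in `]0, +oo[, continuous f} -> {within `[a, b], continuous f}.
Proof.
move=> a0 cf; apply: continuous_in_subspaceT => x; rewrite inE/= in_itv/=.
by move=> /andP[ax _]; apply: cf; rewrite in_itv/= andbT (lt_le_trans a0).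
Qed.

(** * Change of variables and reflection on half-lines *)

Lemma ge0_integration_by_substitution_powR {R : realType} (p : R) (G : R -> R) :
  0 < p -> {in `]0, +oo[, continuous G} -> (forall x, 0 < x -> 0 <= G x) ->
  (\int[mu]_(x in `]0%R, +oo[) (G x)%:E =
   \int[mu]_(x in `]0%R, +oo[)
     (G (x `^ p) * (p * x `^ (p - 1)))%:E)%E.
Proof.
move=> p0 cG G0.
have cGp : {in `]0, +oo[, continuous (fun x => G (x `^ p) * (p * x `^ (p - 1)))}.
  move=> x x0; apply: cvgM; last first.
    by apply: cvgM; [exact: cvg_cst|exact: continuous_powR].
  apply: continuous_comp; first exact: continuous_powR.
  apply: cG; move: x0; rewrite !in_itv/= !andbT; exact: powR_gt0.
have L := ge0_integral_expanding_itv_cvg p0 (continuous_oy_measurable cG) G0.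
apply: (cvg_unique _ L) => //.
suff -> : (fun n => \int[mu]_(x in expanding_itv p n) (G x)%:E)%E =
   (fun n => \int[mu]_(x in expanding_itv 1 n)
     (G (x `^ p) * (p * x `^ (p - 1)))%:E)%E.
  have mGp := continuous_oy_measurable cGp.
  apply: (ge0_integral_expanding_itv_cvg ltr01 mGp) => x x0.
  by rewrite mulr_ge0 ?G0 ?powR_gt0// mulr_ge0 ?powR_ge0// ltW.
apply/funext => n; rewrite /expanding_itv.
(* The endpoints of [expanding_itv p n] are rewritten as [p]-th powers of those of
   [expanding_itv 1 n], the shape that the substitution rule expects. *)
have e q : n.+1%:R `^ (q * p) = (n.+1%:R `^ q) `^ p :> R by exact: powRrM.
rewrite -(mulN1r p) e -{2}(mul1r p) e.
set a := _ `^ (-1); set b := _ `^ 1.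
have a0 : 0 < a by exact: powR_gt0.
have ab : a <= b.
  by apply: ler_powR; rewrite ?ler1n//; lra.
have b0 := lt_le_trans a0 ab.
have dF x : 0 < x -> (@powR R ^~ p)^`()%classic x = p * x `^ (p - 1).
  by move=> x0; rewrite powR_derive1// in_itv/= x0.
have cF' : {in `]0, +oo[, continuous (@powR R ^~ p)^`()%classic}.
  move=> x x0.
  have : (fun x => p * x `^ (p - 1)) y @[y --> x] --> p * x `^ (p - 1).
    by apply: cvgM; [exact: cvg_cst|exact: continuous_powR].
  rewrite /continuous_at dF; last by move: x0; rewrite in_itv/= andbT.
  (* The closed form of the derivative is known at positive points only, which suffices in a
     neighbourhood of [x > 0]. *)
  apply: cvg_trans; apply: near_eq_cvg; near=> y; rewrite dF//.
  near: y; apply: lt_nbhsr; by move: x0; rewrite in_itv/= andbT.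
apply: (etrans (@integration_by_substitution_increasing R (@powR R ^~ p) G a b ab
  _ _ _ _ _ _)).
- move=> x y; rewrite !in_itv/= => /andP[ax _] /andP[ay _] xy.
  by apply: gt0_ltr_powR => //; rewrite nnegrE ltW// (lt_le_trans a0).
- move=> x; rewrite in_itv/= => /andP[ax _]; apply: cF'.
  by rewrite in_itv/= andbT (lt_trans a0).
- apply: cvgP; apply: cvg_at_right_filter; apply: cF'; by rewrite in_itv/= andbT.
- apply: cvgP; apply: cvg_at_left_filter; apply: cF'; by rewrite in_itv/= andbT.
- split.
  + move=> x; rewrite in_itv/= => /andP[ax _]; apply: derivable_powR.
    by rewrite in_itv/= andbT (lt_trans a0).
  + by apply: cvg_at_right_filter; apply: continuous_powR; rewrite in_itv/= andbT.
  + by apply: cvg_at_left_filter; apply: continuous_powR; rewrite in_itv/= andbT.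
- by apply: within_continuous_oy => //; exact: powR_gt0.
- apply: eq_integral => x; rewrite inE/= in_itv/= => /andP[ax _].
  by rewrite fctE/= dF// (lt_le_trans a0).
Unshelve. all: by end_near. Qed.

Lemma integral_itv_even {R : realType} (f : R -> R) a b : 0 < a -> a <= b ->
  {in `]0, +oo[, continuous f} -> (forall x, f (- x) = f x) ->
  (\int[mu]_(x in `[(- b)%R, (- a)%R]) (f x)%:E =
   \int[mu]_(x in `[a, b]) (f x)%:E)%E.
Proof.
move=> a0 ab cf fN; rewrite integration_by_substitution_oppr//.
  by apply: eq_integral => x _; rewrite /= fN.
apply: continuous_in_subspaceT => x; rewrite inE/= in_itv/= => /andP[_ xa].
have <- : f \o -%R = f by apply/funext => y; exact: fN.
apply: continuous_comp; first exact: continuousN.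
by apply: cf; rewrite in_itv/= andbT oppr_gt0 (le_lt_trans xa)// oppr_lt0.
Qed.

Lemma bigcup_expanding_itvN {R : realType} (p : R) : 0 < p ->
  \bigcup_n `[- (n.+1%:R `^ p), - (n.+1%:R `^ (- p))]%classic =
  `]-oo, 0[%classic :> set R.
Proof.
move=> p0; apply/seteqP; split => [x [n _]|x]; rewrite /= !in_itv/=.
  move=> /andP[_]; rewrite lerNr => /(lt_le_trans (powR_gt0 _ (ltr0Sn _ n))).
  by rewrite oppr_gt0.
rewrite -oppr_gt0 => /(powR_exhaust p0)[n]; rewrite lerNr lerNl => /andP[? ?].
by exists n => //=; rewrite in_itv/=; apply/andP.
Qed.

(** Continuity is assumed only away from 0, because the weight is unbounded there when its exponent
    is negative. The negative half-line is therefore exhausted by the mirrored segments, and each is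
    reflected separately. *)
Lemma ge0_integralT_even {R : realType} (f : R -> R) :
  measurable_fun [set: R] f -> {in `]0, +oo[, continuous f} ->
  (forall x, 0 <= f x) -> (forall x, f (- x) = f x) ->
  (\int[mu]_x (f x)%:E =
   \int[mu]_(x in `]0%R, +oo[) (f x)%:E +
   \int[mu]_(x in `]0%R, +oo[) (f x)%:E)%E.
Proof.
move=> mf cf f0 fN.
have mfS (A : set R) : measurable_fun A (EFin \o f).
  by apply/measurable_EFinP; exact: measurable_funS mf.
have -> : [set: R] = `]-oo, 0[%classic `|` `[0, +oo[%classic.
  by rewrite -setCitvl setUv.
rewrite ge0_integral_setU//=; last 2 first.
- by move=> x _; rewrite lee_fin.
- apply/disj_set2P; rewrite -subset0 => x []; rewrite /= !in_itv/= andbT.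
  by move=> /lt_le_trans h /h; rewrite ltxx.
rewrite -integral_itv_obnd_cbnd//; congr (_ + _)%E.
have L := ge0_integral_expanding_itv_cvg ltr01 (continuous_oy_measurable cf)
  (fun x _ => f0 x).
apply: esym; apply: (cvg_unique _ L) => //.
have -> : (fun n => \int[mu]_(x in expanding_itv 1 n) (f x)%:E)%E =
  (fun n => \int[mu]_(x in `[(- (n.+1%:R `^ 1))%R, (- (n.+1%:R `^ (- 1)))%R])
     (f x)%:E)%E.
  apply/funext => n; rewrite integral_itv_even// ?powR_gt0//.
  by apply: ler_powR; rewrite ?ler1n//; lra.
rewrite -(bigcup_expanding_itvN ltr01).
apply: ge0_nondecreasing_set_cvg_integral => //.
- apply/nondecreasing_seqP => n; rewrite subsetEset => x.
  have /nondecreasing_seqP/(_ n) := nondecreasing_expanding_itv (@ltr01 R).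
  rewrite subsetEset => /(_ (- x)); rewrite /expanding_itv/= !in_itv/=.
  move=> H /andP[xb ax].
  have /H/andP[ax' xb'] : n.+1%:R `^ (- 1) <= - x <= n.+1%:R `^ 1.
    by rewrite lerNr ax lerNl xb.
  by rewrite lerNl xb' lerNr ax'.
- by move=> i; exact: mfS.
- by move=> i x _; rewrite lee_fin.
by exact: mfS.
Qed.

(** * The Gamma function: recurrence and finiteness *)

Definition Gamma_integrand {R : realType} (x u : R) : R :=
  u `^ (x - 1) * expR (- u).

Lemma Gamma_integrand_ge0 {R : realType} (x u : R) : 0 <= Gamma_integrand x u.
Proof. by rewrite mulr_ge0 ?powR_ge0 ?expR_ge0. Qed.

Lemma continuous_expRN {R : realType} : continuous (fun x : R => expR (- x)).
Proof.
move=> x; apply: (@continuous_comp _ _ _ (fun x : R => - x) expR).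
  exact: continuousN.
exact: continuous_expR.
Qed.

Lemma continuous_Gamma_integrand {R : realType} (x : R) :
  {in `]0, +oo[, continuous (Gamma_integrand x)}.
Proof.
move=> u u0; apply: cvgM; first exact: continuous_powR.
exact: continuous_expRN.
Qed.

Lemma is_derive_expRN {R : realType} (u : R) :
  is_derive u 1 (fun u => - expR (- u)) (expR (- u)).
Proof.
apply: is_derive_eq.
by rewrite mulrN1 opprK.
Qed.

Lemma derivable_oo_LRcontinuous_pos {R : realType} (F : R -> R) a b :
  0 < a -> a < b ->
  (forall x, 0 < x -> derivable F x 1) -> derivable_oo_LRcontinuous F a b.
Proof.
move=> a0 ab dF.
have cF x : 0 < x -> {for x, continuous F}.
  by move=> x0; apply: differentiable_continuous; exact/derivable1_diffP/dF.
split.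
- by move=> x; rewrite in_itv/= => /andP[ax _]; apply: dF; exact: lt_trans ax.
- exact/cvg_at_right_filter/cF.
- by apply/cvg_at_left_filter/cF; exact: lt_trans ab.
Qed.

(* Boundary term of the integration by parts on [expanding_itv 1 n]. *)
Definition Gamma_boundary {R : realType} (x : R) (n : nat) : R :=
  n.+1%:R `^ (- x) * expR (- n.+1%:R^-1) - n.+1%:R `^ x * expR (- n.+1%:R).

Lemma Gamma_boundary_cvg0 {R : realType} (x : R) : 0 < x ->
  Gamma_boundary x @ \oo --> 0.
Proof.
move=> x0; rewrite -(subr0 0); apply: cvgB.
- apply: (@squeeze_cvgr _ _ _ _ (cst 0) (fun n => (n.+1%:R^-1) `^ x)).
  + near=> n; rewrite mulr_ge0 ?powR_ge0 ?expR_ge0//=.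
    have -> : n.+1%:R `^ (- x) = n.+1%:R^-1 `^ x :> R.
      by rewrite -powR_inv1// -powRrM mulN1r.
    by rewrite ler_piMr ?powR_ge0// expR_le1 oppr_le0 invr_ge0.
  + exact: cvg_cst.
  + apply: (cvg_at_rightP _ _ _).1 (powR_cvg0 x0) _ _.
    by split; [move=> n; rewrite invr_gt0|exact: cvg_harmonic].
(* This [m] exceeds [x + 1]. With [y = n + 1], the exponential series gives
   [y^(x+1) <= y^m <= m! exp(y)], so the term is at most [m! / y]. *)
- pose m := (Num.truncn x).+2.
  apply: (@squeeze_cvgr _ _ _ _ (cst 0) (fun n => m`!%:R * harmonic n)).
  + near=> n; rewrite mulr_ge0 ?powR_ge0 ?expR_ge0//=.
    rewrite expRN ler_pdivrMr ?expR_gt0// /harmonic mulrAC ler_pdivlMr//.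
    have : n.+1%:R ^+ m / m`!%:R <= expR n.+1%:R :> R.
      apply: le_trans (expR_ge1Dxn (Num.truncn x).+1 (ler0n R n.+1)).
      by rewrite lerDr.
    rewrite ler_pdivrMr ?ltr0n ?fact_gt0// mulrC; apply: le_trans.
    rewrite -{2}(powRr1 (ler0n R n.+1)) -powRD; last by rewrite pnatr_eq0 implybT.
    rewrite -powR_mulrn//; apply: ler_powR; first by rewrite ler1n.
    by rewrite /m -natr1 lerD2r ltW// truncnS_gt.
  + exact: cvg_cst.
  + rewrite -(mulr0 m`!%:R); apply: cvgM; first exact: cvg_cst.
    exact: cvg_harmonic.
Unshelve. all: by end_near. Qed.

Lemma integral_GammaS_expanding {R : realType} (x : R) n : (0 < n)%N ->
  (\int[mu]_(u in expanding_itv 1 n) (Gamma_integrand (x + 1) u)%:E =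
   (Gamma_boundary x n)%:E +
    x%:E * \int[mu]_(u in expanding_itv 1 n) (Gamma_integrand x u)%:E)%E.
Proof.
move=> n0; rewrite /expanding_itv.
set a := _ `^ (-1); set b := _ `^ 1.
have a0 : 0 < a by exact: powR_gt0.
have ab : a < b.
  rewrite /a /b powRN powRr1// (@le_lt_trans _ _ 1)//; last by rewrite ltr1n.
  by rewrite invf_le1// ler1n.
have b0 := lt_trans a0 ab.
transitivity (\int[mu]_(u in `[a, b]) (u `^ x * expR (- u))%:E)%E.
  by apply: eq_integral => u _; rewrite /Gamma_integrand addrK.
pose f u : R := x * u `^ (x - 1); pose G u : R := - expR (- u).
have dF (u : R) : 0 < u -> is_derive u 1 (@powR R ^~ x) (f u) by exact: is_derive1_powR.
have dG (u : R) : is_derive u 1 G (expR (- u)) by exact: is_derive_expRN.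
rewrite (@integration_by_parts R (@powR R ^~ x) G f (fun u => expR (- u)) a b ab).
- congr (_ + _)%E.
    congr EFin; rewrite /G /Gamma_boundary /a /b powRr1//.
    by rewrite -powRrM mulN1r powR_inv1//; ring.
  transitivity (- \int[mu]_(u in `[a, b])
      ((- x)%:E * (Gamma_integrand x u)%:E))%E.
    congr (- _)%E; apply: eq_integral => u _; rewrite -EFinM; congr EFin.
    by rewrite /f /G /Gamma_integrand; ring.
  rewrite integralZl//; first by rewrite EFinN mulNe oppeK.
  apply: continuous_compact_integrable; first exact: segment_compact.
  by apply: within_continuous_oy => //; exact: continuous_Gamma_integrand.
- apply: within_continuous_oy => // u u0.
  by apply: cvgM; [exact: cvg_cst|exact: continuous_powR].
- by apply: derivable_oo_LRcontinuous_pos => // u /dF[].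
- move=> u; rewrite in_itv/= => /andP[au _].
  by rewrite derive1E; have [_ ->] := dF _ (lt_trans a0 au).
- by apply: within_continuous_oy => // u _; exact: continuous_expRN.
- by apply: derivable_oo_LRcontinuous_pos => // u _; have [] := dG u.
- by move=> u _; rewrite derive1E; have [_ ->] := dG u.
Qed.

(** [Gamma] is the [fine] of this integral, and [fine] sends an infinite value to 0. The recurrence
    is therefore proved first in the extended reals, and finiteness is deduced from it. *)
Definition EGamma {R : realType} (x : R) : \bar R :=
  (\int[mu]_(u in `]0%R, +oo[) (Gamma_integrand x u)%:E)%E.

Lemma EGamma_ge0 {R : realType} (x : R) : (0 <= EGamma x)%E.
Proof. by apply: integral_ge0 => u _; rewrite lee_fin Gamma_integrand_ge0. Qed.

Lemma EGammaS {R : realType} (x : R) : 0 < x -> EGamma (x + 1) = (x%:E * EGamma x)%E.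
Proof.
move=> x0.
have L (y : R) : (\int[mu]_(u in expanding_itv 1 n) (Gamma_integrand y u)%:E
    @[n --> \oo] --> EGamma y)%E.
  apply: ge0_integral_expanding_itv_cvg => //.
    apply: continuous_oy_measurable; exact: continuous_Gamma_integrand.
  by move=> u _; exact: Gamma_integrand_ge0.
have Lx := L (x + 1); apply: (cvg_unique (@ereal_hausdorff R) Lx).
rewrite -(add0e (x%:E * EGamma x)%E).
have H : (((Gamma_boundary x n)%:E +
    x%:E * \int[mu]_(u in expanding_itv 1 n) (Gamma_integrand x u)%:E)
    @[n --> \oo] --> 0 + x%:E * EGamma x)%E.
  apply: cvgeD; last exact: cvgeZl.
    by rewrite fin_num_adde_defr.
  by apply/cvg_EFin; [exact: nearW|exact: Gamma_boundary_cvg0].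
apply: cvg_trans H; apply: near_eq_cvg; near=> n.
rewrite integral_GammaS_expanding//; near: n; exact: nbhs_infty_gt.
Unshelve. all: by end_near. Qed.

Lemma measurable_Gamma_integrand {R : realType} (x : R) (D : set R) :
  measurable_fun D (Gamma_integrand x).
Proof.
apply: measurable_funTS; apply: measurable_funM; first exact: measurable_powR.
by apply: continuous_measurable_fun; exact: continuous_expRN.
Qed.

(** On the half-line the integrand is the exponential density of rate 1, which has total mass 1. *)
Lemma EGamma1_fin {R : realType} : (EGamma (1 : R) < +oo)%E.
Proof.
apply: (@le_lt_trans _ _ (\int[mu]_x (exponential_pdf (1 : R) x)%:E)%E); last first.
  by rewrite integral_exponential_pdf// ltry.
have mpdf D : measurable_fun D (EFin \o exponential_pdf (1 : R)).
  by apply/measurable_EFinP/measurable_funTS; exact: measurable_exponential_pdf.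
have pdf0 (x : R) : (0 <= (exponential_pdf 1 x)%:E)%E.
  by rewrite lee_fin exponential_pdf_ge0.
apply: (@le_trans _ _ (\int[mu]_(x in `]0%R, +oo[)
    (exponential_pdf (1 : R) x)%:E)%E); last first.
  by apply: ge0_subset_integral => //; exact: mpdf.
apply: ge0_le_integral => //.
- by move=> u _; rewrite lee_fin Gamma_integrand_ge0.
- by apply/measurable_EFinP; exact: measurable_Gamma_integrand.
- exact: mpdf.
- move=> u; rewrite /= in_itv/= andbT => /ltW u0.
  by rewrite exponential_pdfE// lee_fin /Gamma_integrand subrr powRr0 !mul1r mulN1r.
Qed.

(** Induction on an integer bound for [x]: the recurrence lowers any argument above 1, which leaves
    the case [x <= 1]. *)
Lemma EGamma_fin {R : realType} (x : R) : 0 < x -> (EGamma x < +oo)%E.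
Proof.
move=> x0; have [n xn] : exists n : nat, x <= n.+1%:R.
  by exists (Num.truncn x); exact/ltW/truncnS_gt.
elim: n x x0 xn => [|n IHn] x x0 xn; last first.
  have [x1|x1] := leP x 1; first by apply: IHn; rewrite // (le_trans x1)// ler1n.
  rewrite -(subrK 1 x) EGammaS ?subr_gt0//.
  rewrite lte_mul_pinfty ?lee_fin ?subr_ge0 ?(ltW x1)//.
  by apply: IHn; rewrite ?subr_gt0// lerBlDr natr1.
(* For [0 < x <= 1], [u `^ x <= 1 + u] bounds [x Gamma(x) = Gamma(x + 1)] by
   [Gamma(1) + Gamma(2)]. *)
have : (x%:E * EGamma x < +oo)%E.
  rewrite -EGammaS//.
  apply: (@le_lt_trans _ _ (EGamma 1 + EGamma (1 + 1))%E); last first.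
    by rewrite EGammaS// mul1e lte_add_pinfty// EGamma1_fin.
  rewrite /EGamma -ge0_integralD//.
  - apply: ge0_le_integral => //.
    + by move=> u _; rewrite lee_fin Gamma_integrand_ge0.
    + by apply/measurable_EFinP; exact: measurable_Gamma_integrand.
    + by apply: emeasurable_funD; apply/measurable_EFinP;
        exact: measurable_Gamma_integrand.
    + move=> u; rewrite /= in_itv/= andbT => u0; rewrite -EFinD lee_fin.
      rewrite /Gamma_integrand !addrK subrr -mulrDl ler_wpM2r ?expR_ge0//.
      rewrite powRr0 powRr1 ?(ltW u0)//.
      have [u1|u1] := leP 1 u.
        by apply: (le_trans (ler1_powR u1 xn)); rewrite lerDr.
      rewrite -[leLHS]addr0 lerD ?(ltW u0)//.
      by rewrite -(powRr0 u); apply: ger_powR; rewrite ?u0 ?(ltW u1) ?(ltW x0).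
  - by move=> u _; rewrite lee_fin Gamma_integrand_ge0.
  - by apply/measurable_EFinP; exact: measurable_Gamma_integrand.
  - by move=> u _; rewrite lee_fin Gamma_integrand_ge0.
  - by apply/measurable_EFinP; exact: measurable_Gamma_integrand.
(* As [x > 0], an infinite [EGamma x] would make the product infinite. *)
have := EGamma_ge0 x; case: (EGamma x) => [r _ _| _|//]; first by rewrite ltry.
by rewrite gt0_muley ?lte_fin.
Qed.

Lemma GammaE {R : realType} (x : R) : 0 < x -> (Gamma x)%:E = EGamma x.
Proof. by move=> x0; rewrite fineK// ge0_fin_numE ?EGamma_ge0// EGamma_fin. Qed.

Lemma GammaS {R : realType} (x : R) : 0 < x -> Gamma (x + 1) = x * Gamma x.
Proof.
move=> x0; apply: EFin_inj; rewrite EFinM !GammaE ?addr_gt0//; exact: EGammaS.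
Qed.

Lemma Gamma_pochhammer {R : realType} (x : R) n : 0 < x ->
  Gamma (x + n%:R) = pochhammer x n * Gamma x.
Proof.
move=> x0; elim: n => [|n IHn]; first by rewrite addr0 /pochhammer big_ord0 mul1r.
rewrite -natr1 addrA GammaS ?IHn; last by rewrite ltr_wpDr.
by rewrite /pochhammer big_ord_recr/=; ring.
Qed.

(** * Moments of the cubic weight and the dominating function *)

Definition cubic_weight {R : realType} (l s : R) : R := s `^ l * expR (- s ^+ 3).

Lemma cubic_weight_ge0 {R : realType} (l s : R) : 0 <= cubic_weight l s.
Proof. by rewrite mulr_ge0 ?powR_ge0 ?expR_ge0. Qed.

Lemma measurable_cubic_weight {R : realType} (l : R) (D : set R) :
  measurable_fun D (cubic_weight l).
Proof.
apply: measurable_funTS; apply: measurable_funM; first exact: measurable_powR.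
by apply: measurableT_comp => //; apply: measurableT_comp.
Qed.

Lemma integral_cubic_weight {R : realType} (l : R) : -1 < l ->
  (\int[mu]_(s in `]0%R, +oo[) (cubic_weight l s)%:E =
   (3^-1 * Gamma ((l + 1) / 3))%:E)%E.
Proof.
move=> l1; have a0 : 0 < (l + 1) / 3 by lra.
rewrite EFinM GammaE// /EGamma.
have -> := ge0_integration_by_substitution_powR (ltr0Sn R 2)
  (@continuous_Gamma_integrand R ((l + 1) / 3))
  (fun x _ => Gamma_integrand_ge0 _ x).
transitivity (3^-1%:E *
    \int[mu]_(s in `]0%R, +oo[) (3%:E * (cubic_weight l s)%:E))%E.
  rewrite ge0_integralZl_EFin//.
  - by rewrite muleA -EFinM mulVf// mul1e.
  - by move=> s _; rewrite lee_fin cubic_weight_ge0.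
  - by apply/measurable_EFinP; exact: measurable_cubic_weight.
congr (_ * _)%E; apply: eq_integral => s; rewrite inE/= in_itv/= andbT => s0.
rewrite -EFinM; congr EFin; rewrite /Gamma_integrand /cubic_weight.
(* The exponent [l] splits into [3 a], from the Gamma integrand at [s ^ 3], and [2], from the
   derivative [3 s ^ 2]. *)
set a := _ / 3 - 1; have -> : l = 3%:R * a + (3%:R - 1) by rewrite /a; field.
rewrite -(powR_mulrn 3 (ltW s0)) -powRrM.
rewrite (@powRD _ s (3 * a)) ?(gt_eqF s0) ?implybT//.
ring.
Qed.

Lemma integrable_cubic_weight {R : realType} (l : R) : -1 < l ->
  lebesgue_measure.-integrable (`]0, +oo[%classic : set R)
    (fun s => (cubic_weight l s)%:E).
Proof.
move=> l1; apply/integrableP; split.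
  by apply/measurable_EFinP; exact: measurable_cubic_weight.
under eq_integral do rewrite gee0_abs ?lee_fin ?cubic_weight_ge0//.
by rewrite integral_cubic_weight// ltry.
Qed.

Lemma integrable_cubic_weight_expR {R : realType} (l t : R) : -1 < l ->
  lebesgue_measure.-integrable (`]0, +oo[%classic : set R)
    (fun s => (cubic_weight l s * expR (t * s))%:E).
Proof.
move=> l1.
have l0 : 0 < l + 1 by lra.
(* The extra 1 pays for the factor [expR (- s)] of the Gamma integrand and ensures [1 <= b]. *)
pose b := `|t| + 1.
have b1 : 1 <= b by rewrite lerDr.
have iG : lebesgue_measure.-integrable (`]0, +oo[%classic : set R)
    (fun s => ((expR (b ^+ 2))%:E * (Gamma_integrand (l + 1) s)%:E)%E).
  apply: integrableZl => //; apply/integrableP; split.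
    by apply/measurable_EFinP; exact: measurable_Gamma_integrand.
  under eq_integral do rewrite gee0_abs ?lee_fin ?Gamma_integrand_ge0//.
  exact: EGamma_fin.
apply: (le_integrable _ _ _ iG) => //.
  apply/measurable_EFinP; apply: measurable_funM; first exact: measurable_cubic_weight.
  by apply: measurable_funTS; apply: measurableT_comp => //; apply: measurable_funM.
move=> s; rewrite /= in_itv/= andbT => s0.
rewrite /= -?EFinM lee_fin ger0_norm; last first.
  by apply: mulr_ge0; [exact: cubic_weight_ge0|exact: expR_ge0].
rewrite ger0_norm; last first.
  by apply: mulr_ge0; [exact: expR_ge0|exact: Gamma_integrand_ge0].
rewrite /cubic_weight /Gamma_integrand addrK mulrCA -mulrA ler_wpM2l ?powR_ge0//.
rewrite -!expRD ler_expR.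
have tb : t <= b - 1 by rewrite addrK ler_norm.
have ts : t * s <= (b - 1) * s by rewrite ler_wpM2r// ltW.
(* [|t| s - s^3 <= b^2 - s], so that [Gamma (l + 1)] dominates. *)
suff : b * s <= b ^+ 2 + s ^+ 3 by nra.
(* If [s <= b] then [b s <= b^2]; otherwise [s > b >= 1] gives [b s <= s^2 <= s^3]. *)
have [sb|bs] := leP s b.
  by rewrite ler_wpDr ?exprn_ge0 ?(ltW s0)// expr2 ler_wpM2l//; lra.
by rewrite ler_wpDl ?exprn_ge0//; nra.
Qed.

(** * The exponential series split modulo 3 *)

Definition exp_coeff3 {R : realType} (j : nat) (x : R) (k : nat) : R :=
  exp_coeff x (k * 3 + j).

Lemma sum_split3 {R : nmodType} (v : nat -> R) n :
  \sum_(0 <= i < n * 3) v i =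
  \sum_(0 <= k < n) v (k * 3 + 0)%N + \sum_(0 <= k < n) v (k * 3 + 1)%N +
  \sum_(0 <= k < n) v (k * 3 + 2)%N.
Proof.
rewrite -!big_split/=; elim: n => [|n IHn]; first by rewrite !big_geq.
rewrite mulSnr 3?addnS addn0 !big_nat_recr//= IHn !addnS !addn0 !addrA//.
Qed.

Lemma series_exp_coeff_le {R : realType} (x : R) n : 0 <= x ->
  series (exp_coeff x) n <= expR x.
Proof.
move=> x0; apply: nondecreasing_cvgn_le; last exact: is_cvg_series_exp_coeff.
by apply: nondecreasing_series => m _ _; exact: exp_coeff_ge0.
Qed.

(** The absolute values form one residue class of the series at [|x|], whose terms are nonnegative.
    Being uniform in [n], the bound yields both absolute convergence and the domination used
    below. *)
Lemma normed_series_exp_coeff3_le {R : realType} (j : nat) (x : R) n : (j < 3)%N ->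
  [normed series (exp_coeff3 j x)] n <= expR `|x|.
Proof.
move=> j3; apply: le_trans (series_exp_coeff_le (n * 3) (normr_ge0 x)).
have -> : [normed series (exp_coeff3 j x)] n = series (exp_coeff3 j `|x|) n.
  apply: eq_bigr => k _.
  by rewrite /exp_coeff3 /exp_coeff/= normrM normrX [X in _ * X]ger0_norm.
rewrite /series/= (sum_split3 (exp_coeff `|x|)).
have s0 i : 0 <= \sum_(0 <= k < n) exp_coeff `|x| (k * 3 + i)%N.
  by apply: sumr_ge0 => k _; exact: exp_coeff_ge0.
have := (s0 0%N, s0 1%N, s0 2%N).
case: j j3 => [|[|[|//]]] _ /=; rewrite /exp_coeff3 => -[[]]; lra.
Qed.

Lemma is_cvg_series_exp_coeff3 {R : realType} (j : nat) (x : R) : (j < 3)%N ->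
  cvgn (series (exp_coeff3 j x)).
Proof.
move=> j3; apply: normed_cvg; apply: nondecreasing_is_cvgn.
  by apply: nondecreasing_series => n _ _; exact: normr_ge0.
exists (expR `|x|) => _ [n _ <-]; exact: normed_series_exp_coeff3_le.
Qed.

Definition expR3 {R : realType} (j : nat) (x : R) : R :=
  limn (series (exp_coeff3 j x)).

(** The partial sums of length [3 n] regroup by residue class, and this subsequence keeps the limit
    of the whole series. *)
Lemma expR3_sum {R : realType} (x : R) : expR x = expR3 0 x + expR3 1 x + expR3 2 x.
Proof.
have H : series (exp_coeff x) (n * 3)%N @[n --> \oo] -->
    expR3 0 x + expR3 1 x + expR3 2 x.
  have -> : (fun n => series (exp_coeff x) (n * 3)%N) =
    (fun n => series (exp_coeff3 0 x) n + series (exp_coeff3 1 x) n +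
      series (exp_coeff3 2 x) n).
    by apply/funext => n; rewrite {1}/series/= sum_split3.
  by apply: cvgD; [apply: cvgD|]; exact: is_cvg_series_exp_coeff3.
apply: (cvg_unique _ _ H) => //.
apply: (@cvg_comp _ _ _ (fun n => n * 3)%N (series (exp_coeff x)) _ \oo); last first.
  exact: is_cvg_series_exp_coeff.
by apply: cvg_mulnr.
Qed.

(** * Factorials as Pochhammer products *)

(** Each step of [k] adds three consecutive factors [3k + j + i], [i = 1, 2, 3]; extracting 3 from
    each gives 27 and the next factor [(j + i) / 3 + k] of each symbol. *)
Lemma factM3 {R : realType} (k j : nat) :
  ((k * 3 + j)`!)%:R = j`!%:R * 27 ^+ k * pochhammer ((j%:R + 1) / 3) k *
    pochhammer ((j%:R + 2) / 3) k * pochhammer ((j%:R + 3) / 3) k :> R.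
Proof.
elim: k => [|k IHk]; first by rewrite /pochhammer !big_ord0 expr0 !mulr1.
have -> : (k.+1 * 3 + j)%N = (k * 3 + j).+3 by rewrite mulSnr addnAC addn3.
rewrite !factS !natrM IHk /pochhammer !big_ord_recr/= exprS -!natr1 natrD natrM.
by field.
Qed.

Lemma pochhammer1 {R : realType} k : pochhammer 1 k = k`!%:R :> R.
Proof.
elim: k => [|k IHk]; first by rewrite /pochhammer big_ord0.
by rewrite factS natrM -IHk /pochhammer big_ord_recr/= mulrC -natr1 addrC.
Qed.

Lemma pochhammer_gt0 {R : realType} (a : R) k : 0 < a -> 0 < pochhammer a k.
Proof. by move=> a0; apply: prodr_gt0 => i _; rewrite ltr_wpDr. Qed.

(* Convergence of [u] itself is not assumed: for [c = 0] both sides vanish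
   whatever [limn u] is. *)
Lemma mulr_limn {R : realType} (c : R) (u : nat -> R) (l : R) :
  c * u n @[n --> \oo] --> l -> c * limn u = l.
Proof.
have [->|c0] := eqVneq c 0.
  rewrite mul0r => h; apply: (cvg_unique (@Rhausdorff R) _ h).
  have -> : (fun n => 0 * u n) = (fun=> 0) by apply/funext => n; rewrite mul0r.
  exact: cvg_cst.
move=> h; have ul : u @ \oo --> c^-1 * l.
  have -> : u = (fun n => c^-1 * (c * u n)).
    by apply/funext => n; rewrite mulKf.
  by apply: cvgM => //; exact: cvg_cst.
by rewrite (cvg_lim _ ul)// mulVKf.
Qed.

Lemma cubic_weightX {R : realType} (l s : R) m : 0 < s ->
  cubic_weight l s * s ^+ m = cubic_weight (l + m%:R) s.
Proof.
move=> s0; rewrite /cubic_weight powRD; last by rewrite (gt_eqF s0) implybT.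
by rewrite powR_mulrn ?(ltW s0)// mulrAC.
Qed.

(** * Termwise integration and the hypergeometric series *)

(** For [-1 < l], the term of index [3k + j] of [expR (t * s)], integrated against
    [cubic_weight l]. *)
Definition moment_coeff3 {R : realType} (l t : R) (j k : nat) : R :=
  exp_coeff3 j t k * (3^-1 * Gamma ((l + (k * 3 + j)%:R + 1) / 3)).

Lemma integral_partial_sum {R : realType} (l t : R) (j n : nat) : -1 < l ->
  (\int[mu]_(s in `]0%R, +oo[)
     (cubic_weight l s * series (exp_coeff3 j (t * s)) n)%:E =
   (series (moment_coeff3 l t j) n)%:E)%E.
Proof.
move=> l1.
have lk k : -1 < l + (k * 3 + j)%:R by rewrite ltr_wpDr.
transitivity (\int[mu]_(s in `]0%R, +oo[)
   \sum_(k <- index_iota 0 n) (exp_coeff3 j t k)%:E *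
     (cubic_weight (l + (k * 3 + j)%:R) s)%:E)%E.
  apply: eq_integral => s; rewrite inE/= in_itv/= andbT => s0.
  under eq_bigr do rewrite -EFinM.
  rewrite sumEFin; congr EFin; rewrite /series/= mulr_sumr.
  apply: eq_bigr => k _; rewrite -cubic_weightX// /exp_coeff3 /exp_coeff/= exprMn.
  ring.
rewrite integral_sum//; last first.
  by move=> k; apply: integrableZl => //; exact: integrable_cubic_weight.
rewrite -sumEFin; apply: eq_bigr => k _.
rewrite integralZl//; last exact: integrable_cubic_weight.
by rewrite integral_cubic_weight// -EFinM.
Qed.

(** Dominated convergence. The integrability half serves to read the limit as a real number and to
    add the three class integrals, whose integrands can be negative for [t < 0]. *)
Lemma cvg_moment_series {R : realType} (l t : R) (j : nat) : -1 < l -> (j < 3)%N ->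
  lebesgue_measure.-integrable (`]0, +oo[%classic : set R)
    (fun s => (cubic_weight l s * expR3 j (t * s))%:E) /\
  ((series (moment_coeff3 l t j) n)%:E @[n --> \oo] -->
   \int[mu]_(s in `]0%R, +oo[) (cubic_weight l s * expR3 j (t * s))%:E)%E.
Proof.
move=> l1 j3.
pose f_ n s : \bar R := (cubic_weight l s * series (exp_coeff3 j (t * s)) n)%:E.
pose g s : \bar R := (cubic_weight l s * expR (`|t| * s))%:E.
have mf_ n (D : set R) : measurable_fun D (f_ n).
  apply/measurable_EFinP; apply: measurable_funM; first exact: measurable_cubic_weight.
  apply: measurable_sum => k.
  apply: measurable_funM => //.
  by apply: measurable_funX; exact: measurable_funM.
have f_cvg s : f_ ^~ s @ \oo --> (cubic_weight l s * expR3 j (t * s))%:E.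
  apply/cvg_EFin; first exact: nearW.
  apply: cvgM; first exact: cvg_cst.
  exact: is_cvg_series_exp_coeff3.
pose D : set R := `]0, +oo[%classic.
pose f s := (cubic_weight l s * expR3 j (t * s))%:E.
have mf : measurable_fun D f.
  by apply: (@emeasurable_fun_cvg _ _ _ _ f_) => [n|s _]; [exact: mf_|exact: f_cvg].
have f_f : {ae (@lebesgue_measure R), forall s, D s -> f_ ^~ s @ \oo --> f s}.
  by apply: aeW => s _; exact: f_cvg.
have f_g : {ae (@lebesgue_measure R), forall s n, D s -> (`|f_ n s| <= g s)%E}.
  apply: aeW => s n; rewrite /D/= in_itv/= andbT => s0.
  rewrite lee_fin normrM ger0_norm ?cubic_weight_ge0// ler_wpM2l ?cubic_weight_ge0//.
  apply: le_trans (ler_norm_sum _ _ _) _.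
  apply: le_trans (normed_series_exp_coeff3_le (t * s) n j3) _.
  by rewrite normrM (gtr0_norm s0).
have ig := integrable_cubic_weight_expR `|t| l1.
have mD : measurable D by exact: measurable_itv.
have [intf _ h] := @dominated_convergence _ _ _ (@lebesgue_measure R) D mD _ _ _
  (fun n => mf_ n D) mf f_f ig f_g.
split => //.
have -> : (fun n => (series (moment_coeff3 l t j) n)%:E) =
    (fun n => \int[mu]_(s in `]0%R, +oo[) f_ n s)%E.
  by apply/funext => n; rewrite integral_partial_sum.
exact: h.
Qed.

(** The partial sums agree term by term once the factorial is expanded by [factM3]. The hypothesis
    on [b1] and [b2] records which two of its three Pochhammer symbols remain when the third is
    [k!]. *)
Lemma integral_cubic_weight_expR3 {R : realType} (l t : R) (j : nat) (a b1 b2 : R) :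
  -1 < l -> (j < 3)%N -> a = (l + j%:R + 1) / 3 -> 0 < b1 -> 0 < b2 ->
  (forall k, pochhammer b1 k * pochhammer b2 k * k`!%:R =
    pochhammer ((j%:R + 1) / 3) k * pochhammer ((j%:R + 2) / 3) k *
    pochhammer ((j%:R + 3) / 3) k) ->
  (\int[mu]_(s in `]0%R, +oo[) (cubic_weight l s * expR3 j (t * s))%:E =
   (t ^+ j / j`!%:R * (3^-1 * Gamma a) *
     hypergeometric1F2 a b1 b2 ((t / 3) ^+ 3))%:E)%E.
Proof.
move=> l1 j3 aE b10 b20 bE.
have a0 : 0 < a.
  by rewrite aE divr_gt0// -addrA addrCA ltr_wpDl//; lra.
have [intf h] := cvg_moment_series t l1 j3.
have fin := @integrable_fin_num _ _ _ (@lebesgue_measure R) `]0, +oo[%classic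
  (measurable_itv _) _ intf.
(* When [t = 0] and [0 < j] the prefactor vanishes and cannot be divided out; [mulr_limn] covers
   this case too. *)
rewrite -(fineK fin); congr EFin; apply/esym/mulr_limn.
rewrite -(fineK fin) in h; move/fine_cvg in h.
have -> : (fun n => t ^+ j / j`!%:R * (3^-1 * Gamma a) *
    [series pochhammer a k / (pochhammer b1 k * pochhammer b2 k) *
      (((t / 3) ^+ 3) ^+ k / k`!%:R)]_k n) = series (moment_coeff3 l t j).
  apply/funext => n; rewrite /series/= mulr_sumr; apply: eq_bigr => k _.
  rewrite /moment_coeff3 /exp_coeff3 /exp_coeff/=.
  have -> : (l + (k * 3 + j)%:R + 1) / 3 = a + k%:R.
    by rewrite aE natrD natrM; field.
  rewrite Gamma_pochhammer// factM3.
  (* The three Pochhammer symbols are grouped so that [bE] can rewrite them; the [27 ^+ k] beside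
     them matches the one from [(t / 3) ^+ 3]. *)
  have -> : forall A B C D E : R, A * B * C * D * E = A * B * (C * D * E).
    by move=> *; ring.
  have e27 : 27 = 3 ^+ 3 :> R by ring.
  have -> : ((t / 3) ^+ 3) ^+ k = t ^+ (k * 3) / 27 ^+ k.
    by rewrite e27 -!exprM exprMn exprVn mulnC.
  have n27 : 27 ^+ k != 0 :> R by rewrite expf_neq0// pnatr_eq0.
  rewrite -bE exprD.
  have k0 : k`!%:R != 0 :> R by rewrite pnatr_eq0 -lt0n fact_gt0.
  have j0 : j`!%:R != 0 :> R by rewrite pnatr_eq0 -lt0n fact_gt0.
  have p1 := lt0r_neq0 (pochhammer_gt0 k b10).
  have p2 := lt0r_neq0 (pochhammer_gt0 k b20).
  by field; rewrite k0 j0 p1 p2 n27.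
exact: h.
Qed.

Lemma integral_cubic_expR {R : realType} (l t : R) : -1 < l ->
  (\int[mu]_(s in `]0%R, +oo[) (s `^ l * expR (t * s - s ^+ 3))%:E =
   \int[mu]_(s in `]0%R, +oo[) (cubic_weight l s * expR3 0 (t * s))%:E +
   \int[mu]_(s in `]0%R, +oo[) (cubic_weight l s * expR3 1 (t * s))%:E +
   \int[mu]_(s in `]0%R, +oo[) (cubic_weight l s * expR3 2 (t * s))%:E)%E.
Proof.
move=> l1.
have i j (j3 : (j < 3)%N) := (cvg_moment_series t l1 j3).1.
rewrite -integralD//; [|exact: i|exact: i].
rewrite -integralD//; [|by apply: integrableD => //; exact: i|exact: i].
apply: eq_integral => s _; rewrite -!EFinD; congr EFin.
by rewrite -!mulrDr -expR3_sum /cubic_weight -mulrA -expRD addrC.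
Qed.

(** * From the sextic weight to the closed formula *)

Lemma integral_sextic_cubic {R : realType} (l t : R) :
  (\int[mu]_x
     (`|x| `^ (2 * l + 1) * expR (- x ^+ 6 + t * x ^+ 2))%:E =
   \int[mu]_(s in `]0%R, +oo[)
     (s `^ l * expR (t * s - s ^+ 3))%:E)%E.
Proof.
pose f (x : R) := `|x| `^ (2 * l + 1) * expR (- x ^+ 6 + t * x ^+ 2).
have f0 x : 0 <= f x by apply: mulr_ge0; [exact: powR_ge0|exact: expR_ge0].
have cX n : continuous (fun x : R => x ^+ n) by exact: exprn_continuous.
have mf : measurable_fun [set: R] f.
  apply: measurable_funM.
    apply: (measurableT_comp (@measurable_powR R (2 * l + 1))).
    exact: normr_measurable.
  apply: (measurableT_comp (@measurable_expR R)); apply: continuous_measurable_fun => x.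
  apply: cvgD; first by apply: cvgN; exact: cX.
  by apply: cvgM; [exact: cvg_cst|exact: cX].
rewrite (@ge0_integralT_even _ f)//; last 2 first.
- move=> x x0; apply: cvgM.
    apply: (@continuous_comp _ _ _ (fun x : R => `|x|) (@powR R ^~ (2 * l + 1))).
      exact: norm_continuous.
    apply: continuous_powR; move: x0; rewrite !in_itv/= !andbT normr_gt0.
    exact: lt0r_neq0.
  apply: (@continuous_comp _ _ _ (fun x : R => - x ^+ 6 + t * x ^+ 2) expR);
    last exact: continuous_expR.
  apply: cvgD; first by apply: cvgN; exact: cX.
  by apply: cvgM; [exact: cvg_cst|exact: cX].
- by move=> x; rewrite /f normrN sqrrN -[6%N]/(2 * 3)%N !exprM sqrrN.
rewrite (@ge0_integration_by_substitution_powR _ 2%:R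
  (fun s => s `^ l * expR (t * s - s ^+ 3)))//.
(* The two equal halves merge into [f x + f x], which supplies the 2 of the Jacobian [2 x]; its [x]
   comes from splitting [x^(2l+1)] as [(x^2)^l x]. *)
- rewrite -ge0_integralD//; last 4 first.
  - by move=> x _; rewrite lee_fin.
  - by apply/measurable_EFinP; exact: measurable_funTS.
  - by move=> x _; rewrite lee_fin.
  - by apply/measurable_EFinP; exact: measurable_funTS.
  apply: eq_integral => x; rewrite inE/= in_itv/= andbT => x0.
  rewrite -EFinD; congr EFin.
  rewrite /f gtr0_norm// -powRrM (@powRD _ x (2 * l) 1); last first.
    by rewrite (gt_eqF x0) implybT.
  have -> : 2%:R - 1 = 1 :> R by ring.
  rewrite powRr1 ?(ltW x0)// powR_mulrn ?(ltW x0)// -exprM -[(2 * 3)%N]/6%N.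
  by rewrite [- x ^+ 6 + _]addrC; ring.
- move=> x x0; apply: cvgM; first exact: continuous_powR.
  apply: (@continuous_comp _ _ _ (fun x : R => t * x - x ^+ 3) expR);
    last exact: continuous_expR.
  apply: cvgB; last exact: cX.
  by apply: cvgM; [exact: cvg_cst|exact: cvg_id].
- by move=> x _; apply: mulr_ge0; [exact: powR_ge0|exact: expR_ge0].
Qed.

Theorem lemma3p1 (R : realType) (lambda t : R) (hlambda : -1 < lambda) :
  [/\ sextic_freud_mu0 t lambda =
        (\int[lebesgue_measure]_x
           (`|x| `^ (2 * lambda + 1) * expR (- x ^+ 6 + t * x ^+ 2))%:E)%E,
      (\int[lebesgue_measure]_x
         (`|x| `^ (2 * lambda + 1) * expR (- x ^+ 6 + t * x ^+ 2))%:E)%E =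
        (\int[lebesgue_measure]_(s in `]0%R, +oo[)
           (s `^ lambda * expR (t * s - s ^+ 3))%:E)%E
    & (\int[lebesgue_measure]_(s in `]0%R, +oo[)
         (s `^ lambda * expR (t * s - s ^+ 3))%:E)%E =
      (3^-1 * Gamma (lambda / 3 + 3^-1)
         * hypergeometric1F2 (lambda / 3 + 3^-1) (1 / 3) (2 / 3) ((t / 3) ^+ 3)
       + 3^-1 * t * Gamma (lambda / 3 + 2 / 3)
         * hypergeometric1F2 (lambda / 3 + 2 / 3) (2 / 3) (4 / 3) ((t / 3) ^+ 3)
       + 6^-1 * t ^+ 2 * Gamma (lambda / 3 + 1)
         * hypergeometric1F2 (lambda / 3 + 1) (4 / 3) (5 / 3) ((t / 3) ^+ 3))%:E].
Proof.
split; [by []|exact: integral_sextic_cubic|].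
rewrite integral_cubic_expR//.
have b13 : 0 < 1 / 3 :> R by lra.
have b23 : 0 < 2 / 3 :> R by lra.
have b43 : 0 < 4 / 3 :> R by lra.
have b53 : 0 < 5 / 3 :> R by lra.
have three1 : 3 / 3 = 1 :> R by field.
have [e11 e12 e13] : [/\ 1 + 1 = 2 :> R, 1 + 2 = 3 :> R & 1 + 3 = 4 :> R].
  by split; ring.
have [e21 e22 e23] : [/\ 2 + 1 = 3 :> R, 2 + 2 = 4 :> R & 2 + 3 = 5 :> R].
  by split; ring.
(* For [j = 0, 1, 2] the three symbols have bases [1/3, 2/3, 1], then [2/3, 1, 4/3], then
   [1, 4/3, 5/3]; removing the 1 leaves the lower parameters. *)
rewrite (integral_cubic_weight_expR3 t (a := lambda / 3 + 3^-1) hlambda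
  (isT : (0 < 3)%N) _ b13 b23); last 2 first.
- by field.
- by move=> k; rewrite !add0r three1 pochhammer1.
rewrite (integral_cubic_weight_expR3 t (a := lambda / 3 + 2 / 3) hlambda
  (isT : (1 < 3)%N) _ b23 b43); last 2 first.
- by field.
- by move=> k; rewrite e11 e12 e13 three1 pochhammer1; ring.
rewrite (integral_cubic_weight_expR3 t (a := lambda / 3 + 1) hlambda
  (isT : (2 < 3)%N) _ b43 b53); last 2 first.
- by field.
- by move=> k; rewrite e21 e22 e23 three1 pochhammer1; ring.
rewrite -!EFinD; congr EFin; rewrite !factS fact0.
(* Gamma and hypergeometric values become atoms, so that [field] only has to match the prefactors
   [t^j / (3 j!)]. *)
move: (Gamma _) (Gamma _) (Gamma _) => g0 g1 g2.
move: (hypergeometric1F2 _ (1 / 3) _ _) (hypergeometric1F2 _ (2 / 3) _ _) => h0 h1.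
by move: (hypergeometric1F2 _ _ _ _) => h2; field.
Qed.
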